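(* Let $n\ge1$, $z=(z_1,\dots,z_n)$, $t$ a formal parameter, and $P(z)\in\mathbb{C}[[z]]$ with $o(P(z))\ge2$. Let $Q_t(z)\in\mathbb{C}[[z,t]]$ with $o(Q_t(z))\ge2$ be such that $G_t(z)=z+t\nabla Q_t(z)$ is the formal inverse of $F_t(z)=z-t\nabla P(z)$, and write $Q_t(z)=\sum_{m=1}^\infty Q_{[m]}(z)t^{m-1}$ with $Q_{[m]}(z)\in\mathbb{C}[[z]]$. Then $$Q_{[1]}(z)=P(z),\qquad Q_{[m]}(z)=\frac{1}{2(m-1)}\sum_{\substack{k,l\ge1\\ k+l=m}}\langle\nabla Q_{[k]}(z),\nabla Q_{[l]}(z)\rangle\quad\text{for any } m\ge2.$$ In particular, when $P(z)$ is a polynomial, all $Q_{[m]}(z)$ $(m\ge1)$ are also polynomials.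
   Context: $\nabla$ is the gradient with respect to $z$; $\langle a,b\rangle=\sum_i a_ib_i$. The order $o(\cdot)$ is the lowest total degree in $z$ of a monomial that occurs. Composition of formal maps is in $z$ with $t$ treated as a constant; $G_t$ is the formal inverse of $F_t$ if $F_t(G_t(z))=z=G_t(F_t(z))$. Such a $Q_t$ exists and is unique for every $P$ with $o(P)\ge2$. *)

(* Defs.v *)
From HB Require Import structures.
From mathcomp Require Import all_boot all_order all_algebra.
From mathcomp Require Import boolp reals complex mpoly.

Set Implicit Arguments.
Unset Strict Implicit.
Unset Printing Implicit Defensive.

Import GRing.Theory.

Local Open Scope ring_scope.

(* K[[x_1, ..., x_n]]: a series is the family of its coefficients, indexed by
   the exponents of MathComp's multinomials; f m is the coefficient of x^m. *)
Record mseries (n : nat) (K : Type) :=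
  MSeries { mscoef :> 'X_{1..n} -> K }.

Lemma mseriesP (n : nat) (K : Type) (f g : mseries n K) :
  (forall m, f m = g m) -> f = g.
Proof. by case: f g => [f] [g] /= /funext ->. Qed.

HB.instance Definition _ (n : nat) (K : Type) := gen_eqMixin (mseries n K).
HB.instance Definition _ (n : nat) (K : Type) := gen_choiceMixin (mseries n K).

Section SeriesRing.
Context (n : nat) (K : comNzRingType).
Implicit Types (f g h : mseries n K) (m : 'X_{1..n}) (a b : K).

Definition ms_zero : mseries n K := MSeries (fun=> 0).
Definition ms_opp f : mseries n K := MSeries (fun m => - f m).
Definition ms_add f g : mseries n K := MSeries (fun m => f m + g m).
Definition ms_scale a f : mseries n K := MSeries (fun m => a * f m).
Definition ms_one : mseries n K := MSeries (fun m => (m == 0%MM)%:R).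

(* Cauchy product; the bounds on k.1 and k.2 only make the index set finite. *)
Definition ms_mul f g : mseries n K := MSeries (fun m =>
  \sum_(k : 'X_{1..n < (mdeg m).+1, (mdeg m).+1} | m == (k.1 + k.2)%MM)
    f k.1 * g k.2).

Fact ms_addA : associative ms_add.
Proof. by move=> f g h; apply: mseriesP => m /=; rewrite addrA. Qed.
Fact ms_addC : commutative ms_add.
Proof. by move=> f g; apply: mseriesP => m /=; rewrite addrC. Qed.
Fact ms_add0 : left_id ms_zero ms_add.
Proof. by move=> f; apply: mseriesP => m /=; rewrite add0r. Qed.
Fact ms_addN : left_inverse ms_zero ms_opp ms_add.
Proof. by move=> f; apply: mseriesP => m /=; rewrite addNr. Qed.

HB.instance Definition _ := GRing.isZmodule.Build (mseries n K)
  ms_addA ms_addC ms_add0 ms_addN.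

(* Truncation below total degree d, used to import the ring axioms. *)
Definition ms_trunc (d : nat) f : {mpoly K[n]} :=
  \sum_(m : 'X_{1..n < d}) f m *: 'X_[m].

Lemma ms_truncE d f m : (mdeg m < d)%N -> (ms_trunc d f)@_m = f m.
Proof. exact: mcoeff_mpoly. Qed.

Lemma ms_mulE (p q : {mpoly K[n]}) f g m :
  (forall k, (mdeg k <= mdeg m)%N -> p@_k = f k) ->
  (forall k, (mdeg k <= mdeg m)%N -> q@_k = g k) ->
  ms_mul f g m = (p * q)@_m.
Proof.
move=> pf qg; rewrite mcoeffM /=; apply: eq_bigr => -[k1 k2] /= _.
by rewrite pf ?qg // -ltnS bmdeg.
Qed.

Lemma ms_mul_trunc d f g m : (mdeg m < d)%N ->
  ms_mul f g m = (ms_trunc d f * ms_trunc d g)@_m.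
Proof.
by move=> md; apply: ms_mulE => k km; rewrite ms_truncE // (leq_ltn_trans km).
Qed.

Fact ms_mulA : associative ms_mul.
Proof.
move=> f g h; apply: mseriesP => m; set d := (mdeg m).+1.
rewrite (ms_mulE (p := ms_trunc d f) (q := ms_trunc d g * ms_trunc d h)); last 2 first.
- by move=> k km; rewrite ms_truncE.
- by move=> k km; rewrite (@ms_mul_trunc d).
rewrite (ms_mulE (p := ms_trunc d f * ms_trunc d g) (q := ms_trunc d h)) ?mulrA //.
- by move=> k km; rewrite (@ms_mul_trunc d).
- by move=> k km; rewrite ms_truncE.
Qed.

Fact ms_mulC : commutative ms_mul.
Proof.
by move=> f g; apply: mseriesP => m; rewrite !(ms_mul_trunc _ _ (ltnSn _)) mulrC.
Qed.

Fact ms_mul1 : left_id ms_one ms_mul.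
Proof.
move=> f; apply: mseriesP => m.
rewrite (ms_mulE (p := 1) (q := ms_trunc (mdeg m).+1 f)) ?mul1r ?ms_truncE //.
- by move=> k _; rewrite mcoeff1.
- by move=> k km; rewrite ms_truncE.
Qed.

Fact ms_mulDl : left_distributive ms_mul +%R.
Proof.
move=> f g h; apply: mseriesP => m /=; rewrite -big_split /=.
by apply: eq_bigr => k _; rewrite mulrDl.
Qed.

Fact ms_one_neq0 : ms_one != 0.
Proof.
apply/eqP => /(congr1 (fun f : mseries n K => f 0%MM)) /=.
by rewrite eqxx => /eqP; rewrite oner_eq0.
Qed.

HB.instance Definition _ := GRing.Zmodule_isComNzRing.Build (mseries n K)
  ms_mulA ms_mulC ms_mul1 ms_mulDl ms_one_neq0.

Fact ms_scaleA a b f : ms_scale a (ms_scale b f) = ms_scale (a * b) f.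
Proof. by apply: mseriesP => m /=; rewrite mulrA. Qed.
Fact ms_scale1 : left_id 1 ms_scale.
Proof. by move=> f; apply: mseriesP => m /=; rewrite mul1r. Qed.
Fact ms_scaleDr : right_distributive ms_scale +%R.
Proof. by move=> a f g; apply: mseriesP => m /=; rewrite mulrDr. Qed.
Fact ms_scaleDl f : {morph ms_scale^~ f : a b / a + b}.
Proof. by move=> a b; apply: mseriesP => m /=; rewrite mulrDl. Qed.

HB.instance Definition _ := GRing.Zmodule_isLmodule.Build K (mseries n K)
  ms_scaleA ms_scale1 ms_scaleDr ms_scaleDl.

Fact ms_scaleAl a f g : a *: (f * g) = a *: f * g.
Proof.
apply: mseriesP => m /=; rewrite mulr_sumr.
by apply: eq_bigr => k _; rewrite mulrA.
Qed.

HB.instance Definition _ :=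
  GRing.Lmodule_isLalgebra.Build K (mseries n K) ms_scaleAl.

End SeriesRing.

Section SeriesOperations.
Context (K : comNzRingType).

Definition series_of_mpoly (n : nat) (p : {mpoly K[n]}) : mseries n K :=
  MSeries (fun m => p@_m).

Definition is_polynomial (n : nat) (f : mseries n K) : Prop :=
  exists p : {mpoly K[n]}, f = series_of_mpoly p.

Definition ms_deriv (n : nat) (i : 'I_n) (f : mseries n K) : mseries n K :=
  MSeries (fun m => f (m + U_(i))%MM *+ (m i).+1).

Definition grad (n : nat) (f : mseries n K) : 'I_n -> mseries n K :=
  fun i => ms_deriv i f.

Definition inner (n p : nat) (a b : 'I_n -> mseries p K) : mseries p K :=
  \sum_(i < n) a i * b i.

(* The zero series has infinite order. *)
Definition order_ge (n d : nat) (f : mseries n K) : Prop :=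
  forall m, f m != 0 -> (d <= mdeg m)%N.

(* The substitution f(g_1, ..., g_n) = \sum_k f_k g^k, for g_1, ..., g_n without
   constant term: g^k then has no monomial of degree < |k|, so the coefficient
   at m involves only the k with |k| <= |m|. *)
Definition ms_comp (n p : nat) (f : mseries n K) (g : 'I_n -> mseries p K) :
    mseries p K :=
  MSeries (fun m =>
    (\sum_(k : 'X_{1..n < (mdeg m).+1}) f k *: \prod_(i < n) g i ^+ k i) m).

End SeriesOperations.

(* K[[z, t]] with z = (z_1, ..., z_n) is mseries n.+1 K: the variable of index
   widen_ord (leqnSn n) i is z_i and the last one, of index ord_max, is t. *)
Section SeriesZT.
Context (n : nat) (K : comNzRingType).
Implicit Types (f : mseries n.+1 K) (F G : 'I_n -> mseries n.+1 K).

Definition zidx (i : 'I_n) : 'I_n.+1 := widen_ord (leqnSn n) i.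

Definition zvar (i : 'I_n) : mseries n.+1 K := series_of_mpoly 'X_(zidx i).
Definition tvar : mseries n.+1 K := series_of_mpoly 'X_ord_max.

Definition zexp (m : 'X_{1..n.+1}) : 'X_{1..n} := [multinom m (zidx i) | i < n].

Definition zorder_ge (d : nat) f : Prop :=
  forall m, f m != 0 -> (d <= mdeg (zexp m))%N.

(* The inclusion of K[[z]] into K[[z, t]]. *)
Definition zembed (f : mseries n K) : mseries n.+1 K :=
  MSeries (fun m => if m ord_max == 0%N then f (zexp m) else 0).

(* The coefficient of t^j, an element of K[[z]]. *)
Definition tcoef (j : nat) f : mseries n K :=
  MSeries (fun k => f (mnmwiden k + U_(ord_max) *+ j)%MM).

Definition zgrad f : 'I_n -> mseries n.+1 K := fun i => ms_deriv (zidx i) f.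

(* f(G_1, ..., G_n, t). *)
Definition zcomp f G : mseries n.+1 K :=
  ms_comp f (fun j => if unlift ord_max j is Some i then G i else tvar).

Definition formal_inverse F G : Prop :=
  (forall i, zcomp (F i) G = zvar i) /\ (forall i, zcomp (G i) F = zvar i).

End SeriesZT.

Arguments zvar {n K}.
Arguments tvar {n K}.

(* Main.v *)
Require Import Defs.
From HB Require Import structures.
From mathcomp Require Import all_boot all_order all_algebra.
From mathcomp Require Import boolp reals complex mpoly ring.

Set Implicit Arguments.
Unset Strict Implicit.
Unset Printing Implicit Defensive.

Import GRing.Theory Num.Theory.

Local Open Scope ring_scope.

(* Write u = grad Q. The equation F_t(G_t(z)) = z says u = (grad P)(G_t), so the
   chain rule gives, for each z_j,
     d_j (P(G_t)) = sum_i u_i d_j(z_i + t u_i) = u_j + (t/2) d_j <u, u>,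
   hence Q = P(G_t) - (t/2) <u, u> since no term is free of z. Differentiating
   this identity in t, where d_t (P(G_t)) = <u, u> + (t/2) d_t <u, u>, yields
   the Hamilton-Jacobi equation d_t Q = <u, u> / 2, whose coefficients in t are
   the recursion; at t = 0 the identity reads Q_[1] = P. *)

Section SeriesTheory.
Context (K : comNzRingType).

(** * Coefficients, partial derivatives and order of formal power series *)

Section Coefficients.
Context (n : nat).
Implicit Types (f g : mseries n K) (m : 'X_{1..n}) (p q : {mpoly K[n]}).

(* [mscoef] with its arguments swapped, so that it can be declared additive. *)
Definition mscoef_at m f : K := f m.

Fact mscoef_at_is_additive m : zmod_morphism (mscoef_at m).
Proof. by []. Qed.

HB.instance Definition _ m :=
  GRing.isZmodMorphism.Build (mseries n K) K (mscoef_at m)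
    (mscoef_at_is_additive m).

Lemma mscoef_sum m (I : Type) (r : seq I) (A : pred I) (F : I -> mseries n K) :
  (\sum_(i <- r | A i) F i) m = \sum_(i <- r | A i) F i m.
Proof. exact: (raddf_sum (mscoef_at m)). Qed.

Lemma mscoefMn m f k : (f *+ k) m = f m *+ k.
Proof. exact: (raddfMn (mscoef_at m)). Qed.

(** The coefficient of a product at [m] depends only on coefficients of degree at most [mdeg m].
    Polynomial identities are carried over to series this way, with truncations as [p] and [q]. *)
Lemma mscoefM p q f g m :
  (forall k, (mdeg k <= mdeg m)%N -> p@_k = f k) ->
  (forall k, (mdeg k <= mdeg m)%N -> q@_k = g k) ->
  (f * g) m = (p * q)@_m.
Proof. exact: ms_mulE. Qed.

Lemma mscoefME f g m : (f * g) m =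
  \sum_(k : 'X_{1..n < (mdeg m).+1, (mdeg m).+1} | m == (k.1 + k.2)%MM)
    f k.1 * g k.2.
Proof. by []. Qed.

Lemma series_of_mpolyM p q :
  series_of_mpoly (p * q) = series_of_mpoly p * series_of_mpoly q.
Proof. by apply: mseriesP => m; rewrite (mscoefM (p := p) (q := q)). Qed.

Lemma series_of_mpolyD p q :
  series_of_mpoly (p + q) = series_of_mpoly p + series_of_mpoly q.
Proof. by apply: mseriesP => m /=; rewrite mcoeffD. Qed.

Lemma series_of_mpolyZ a p : series_of_mpoly (a *: p) = a *: series_of_mpoly p.
Proof. by apply: mseriesP => m /=; rewrite mcoeffZ. Qed.

Lemma series_of_mpoly1 : series_of_mpoly (1 : {mpoly K[n]}) = 1.
Proof. by apply: mseriesP => m /=; rewrite mcoeff1. Qed.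

Lemma series_of_mpoly0 : series_of_mpoly (0 : {mpoly K[n]}) = 0.
Proof. by apply: mseriesP => m /=; rewrite mcoeff0. Qed.

Lemma is_polynomial_sum (I : Type) (r : seq I) (A : pred I)
    (F : I -> mseries n K) :
  (forall i, A i -> is_polynomial (F i)) ->
  is_polynomial (\sum_(i <- r | A i) F i).
Proof.
move=> polyF; apply: big_ind => //.
  by exists 0; rewrite series_of_mpoly0.
by move=> _ _ [p ->] [q ->]; exists (p + q); rewrite series_of_mpolyD.
Qed.

Lemma mscoefXM i f m : (series_of_mpoly 'X_i * f) (m + U_(i))%MM = f m.
Proof.
pose q := ms_trunc (mdeg (m + U_(i))).+1 f.
rewrite (mscoefM (p := 'X_i) (q := q)) //; last first.
  by move=> k km; rewrite ms_truncE.
by rewrite mulrC addmC mcoeffMX ms_truncE // ltnS mdegD leq_addr.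
Qed.

(** Multiplication by a variable only shifts exponents, so it can be cancelled over any [K], zero
    divisors or not. This serves to divide by t. *)
Lemma series_mulX_inj i : injective (fun f => series_of_mpoly 'X_i * f).
Proof.
move=> f g /= fg; apply: mseriesP => m.
by rewrite -(mscoefXM i f) fg mscoefXM.
Qed.

Fact ms_deriv_is_additive i : zmod_morphism (@ms_deriv K n i).
Proof. by move=> f g; apply: mseriesP => m /=; rewrite mulrnBl. Qed.

HB.instance Definition _ i :=
  GRing.isZmodMorphism.Build (mseries n K) (mseries n K) (ms_deriv i)
    (ms_deriv_is_additive i).

Lemma ms_deriv_series_of_mpoly i p :
  ms_deriv i (series_of_mpoly p) = series_of_mpoly p^`M(i).
Proof. by apply: mseriesP => m /=; rewrite mcoeff_deriv. Qed.

Lemma mderivXU i j : ('X_j : {mpoly K[n]})^`M(i) = (i == j)%:R.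
Proof.
rewrite mderivX mnm1E eq_sym; case: eqP => [->|_]; last by rewrite scale0r.
by rewrite scale1r -{1}[U_(_)%MM]add0m addmK mpolyX0.
Qed.

Lemma ms_derivX i j :
  ms_deriv i (series_of_mpoly 'X_j) = (i == j)%:R :> mseries n K.
Proof.
rewrite ms_deriv_series_of_mpoly mderivXU.
by case: eqP => _; rewrite ?series_of_mpoly0 ?series_of_mpoly1.
Qed.

Lemma ms_derivM i f g :
  ms_deriv i (f * g) = ms_deriv i f * g + f * ms_deriv i g.
Proof.
apply: mseriesP => m.
(* The derivative at [m] reads degree [mdeg m + 1], so the truncation must keep one degree more than
   usual. *)
pose d := (mdeg m).+2; pose p := ms_trunc d f; pose q := ms_trunc d g.
have mU : mdeg (m + U_(i)) = (mdeg m).+1 by rewrite mdegD mdeg1 addn1.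
rewrite -[LHS]/((f * g) (m + U_(i))%MM *+ _) (mscoefM (p := p) (q := q)); try by
  move=> k; rewrite mU => km; rewrite ms_truncE.
rewrite -mcoeff_deriv mderivM mcoeffD.
congr (_ + _); symmetry; apply: mscoefM => k km;
  rewrite ?mcoeff_deriv ms_truncE ?mdegD ?mdeg1 ?addn1 ?ltnS //;
  exact: leqW.
Qed.

Lemma ms_derivZ i a f : ms_deriv i (a *: f) = a *: ms_deriv i f.
Proof. by apply: mseriesP => m /=; rewrite mulrnAr. Qed.

Lemma is_polynomialM f g :
  is_polynomial f -> is_polynomial g -> is_polynomial (f * g).
Proof. by move=> [p ->] [q ->]; exists (p * q); rewrite series_of_mpolyM. Qed.

Lemma is_polynomialZ a f : is_polynomial f -> is_polynomial (a *: f).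
Proof. by move=> [p ->]; exists (a *: p); rewrite series_of_mpolyZ. Qed.

Lemma is_polynomial_deriv i f : is_polynomial f -> is_polynomial (ms_deriv i f).
Proof. by move=> [p ->]; exists p^`M(i); rewrite ms_deriv_series_of_mpoly. Qed.

(** Every polynomial is built from 1 and the variables by products, scalings and sums. This form
    suits evaluation morphisms and the Leibniz rule better than induction on monomials. *)
Lemma mpoly_ring_ind (A : {mpoly K[n]} -> Prop) :
  A 1 -> (forall i, A 'X_i) -> (forall p q, A p -> A q -> A (p * q)) ->
  (forall a p, A p -> A (a *: p)) -> (forall p q, A p -> A q -> A (p + q)) ->
  forall p, A p.
Proof.
move=> A1 AX AM AZ AD; elim/mpolyind => [|a m p _ _ Ap].
  by rewrite -(scale0r 1); apply: AZ.
apply: AD Ap; apply: AZ; rewrite mpolyXE_id; elim/big_ind: _ => // i _.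
by elim: (m i) => [|k IHk]; rewrite ?expr0 ?exprS //; apply: AM.
Qed.

Lemma order_geP d f :
  order_ge d f <-> (forall m, (mdeg m < d)%N -> f m = 0).
Proof.
split=> [fd m md|fd m]; last by rewrite leqNgt; apply: contra => /fd ->.
by apply/eqP; apply: contraLR md => /fd; rewrite -leqNgt.
Qed.

Lemma order_ge0 f : order_ge 0 f. Proof. by []. Qed.

Lemma order_geM d e f g :
  order_ge d f -> order_ge e g -> order_ge (d + e) (f * g).
Proof.
move=> /order_geP fd /order_geP ge; apply/order_geP => m mde.
rewrite mscoefME big1 // => -[k1 k2] /= /eqP mk.
have [/fd ->|dk1] := ltnP (mdeg k1) d; first by rewrite mul0r.
rewrite (ge k2) ?mulr0 // -(ltn_add2l (mdeg k1)) -mdegD -mk.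
by rewrite (leq_trans mde) // leq_add2r.
Qed.

Lemma order_geX d f k : order_ge d f -> order_ge (d * k) (f ^+ k).
Proof.
move=> fd; elim: k => [|k IHk]; first by rewrite muln0.
by rewrite mulnS exprS; apply: order_geM.
Qed.

End Coefficients.

(** * Substitution of series without constant term, and the chain rule *)

Section Composition.
Context (n p : nat) (g : 'I_n -> mseries p K).
Hypothesis g_order : forall i, order_ge 1 (g i).
(** Evaluation of polynomials at [g], a ring morphism to which [ms_comp] is reduced one coefficient
    at a time. *)
Local Notation subst := (mmap (in_alg (mseries p K)) g).

Lemma substZ a (q : {mpoly K[n]}) : subst (a *: q) = a *: subst q.
Proof. by rewrite mmapZ /= mulr_algl. Qed.

Lemma order_mmap1 (k : 'X_{1..n}) : order_ge (mdeg k) (mmap1 g k).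
Proof.
rewrite /mmap1 mdegE.
elim/big_ind2: _ => // [d f e h|i _]; first exact: order_geM.
by rewrite -{1}[k i]mul1n; apply: order_geX.
Qed.

Lemma ms_comp_truncE f m :
  ms_comp f g m = subst (ms_trunc (mdeg m).+1 f) m.
Proof.
rewrite /= /ms_trunc raddf_sum /=; congr (mscoef _ m).
by apply: eq_bigr => k _; rewrite substZ mmapX.
Qed.

(** By [order_mmap1], a monomial of degree above [mdeg m] evaluates to a series with no term at
    [m]. *)
Lemma subst_eq (q r : {mpoly K[n]}) m :
  (forall k, (mdeg k <= mdeg m)%N -> q@_k = r@_k) -> subst q m = subst r m.
Proof.
move=> qr; apply/eqP; rewrite -subr_eq0.
rewrite -[X in X == 0]/((subst q - subst r) m) -mmapB /mmap mscoef_sum.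
apply/eqP; apply: big1 => k _.
rewrite [in_alg _ _ * _]mulr_algl /= mcoeffB.
have [km|mk] := leqP (mdeg k) (mdeg m); first by rewrite qr // subrr mul0r.
by move/order_geP: (order_mmap1 (k := k)) => ->; rewrite ?mulr0.
Qed.

(** The truncation built into [ms_comp] may be replaced by any polynomial agreeing with [f] up to
    degree [mdeg m]. This freedom lets sums, products and derivatives of truncations stand in for
    truncations of sums, products and derivatives. *)
Lemma ms_compE (f : mseries n K) (q : {mpoly K[n]}) m :
  (forall k, (mdeg k <= mdeg m)%N -> q@_k = f k) ->
  ms_comp f g m = subst q m.
Proof.
move=> qf; rewrite ms_comp_truncE; apply: subst_eq => k km.
by rewrite ms_truncE ?qf.
Qed.

Lemma ms_comp_series_of_mpoly (q : {mpoly K[n]}) :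
  ms_comp (series_of_mpoly q) g = subst q.
Proof. by apply: mseriesP => m; apply: ms_compE. Qed.

Lemma ms_compX i : ms_comp (series_of_mpoly 'X_i) g = g i.
Proof. by rewrite ms_comp_series_of_mpoly mmapX mmap1U. Qed.

Lemma ms_compB f h : ms_comp (f - h) g = ms_comp f g - ms_comp h g.
Proof.
apply: mseriesP => m; pose d := (mdeg m).+1.
rewrite (ms_compE (q := ms_trunc d f - ms_trunc d h)).
  by rewrite mmapB /= -!ms_comp_truncE.
by move=> k km; rewrite mcoeffB !ms_truncE.
Qed.

Lemma ms_comp0 : ms_comp 0 g = 0.
Proof. by rewrite -(subrr (0 : mseries n K)) ms_compB subrr. Qed.

Lemma ms_compM f h : ms_comp (f * h) g = ms_comp f g * ms_comp h g.
Proof.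
apply: mseriesP => m; pose d := (mdeg m).+1.
rewrite (ms_compE (q := ms_trunc d f * ms_trunc d h)).
  rewrite rmorphM !mscoefME; apply: eq_bigr => -[k1 k2] _.
  by congr (_ * _); symmetry; apply: ms_compE => k kk;
    rewrite ms_truncE // ltnS (leq_trans kk) // -ltnS bmdeg.
by move=> k km; symmetry; apply: mscoefM => l lk;
  rewrite ms_truncE // ltnS (leq_trans lk).
Qed.

(** The chain rule for polynomials: both sides are linear in [q] and obey the same Leibniz rule, so
    it is enough to compare them on 1 and on the variables. *)
Lemma ms_deriv_subst j (q : {mpoly K[n]}) :
  ms_deriv j (subst q) = \sum_(i < n) subst q^`M(i) * ms_deriv j (g i).
Proof.
elim/mpoly_ring_ind: q => [|i|r s IHr IHs|a r IHr|r s IHr IHs].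
- rewrite rmorph1 -series_of_mpoly1 ms_deriv_series_of_mpoly.
  rewrite -mpolyC1 mderivC series_of_mpoly0 big1 // => i _.
  by rewrite mderivC rmorph0 mul0r.
- rewrite mmapX mmap1U (bigD1 i) //= big1 ?addr0 => [|l li].
    by rewrite mderivXU eqxx rmorph1 mul1r.
  by rewrite mderivXU (negPf li) rmorph0 mul0r.
- rewrite rmorphM ms_derivM IHr IHs mulr_suml mulr_sumr.
  rewrite -big_split; apply: eq_bigr => i _.
  by rewrite mderivM rmorphD !rmorphM mulrDl mulrAC mulrA.
- rewrite substZ ms_derivZ IHr scaler_sumr.
  by apply: eq_bigr => i _; rewrite mderivZ substZ scalerAl.
- rewrite mmapD raddfD /= IHr IHs -big_split; apply: eq_bigr => i _.
  by rewrite mderivD mmapD mulrDl.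
Qed.

Lemma ms_deriv_comp j f :
  ms_deriv j (ms_comp f g) =
  \sum_(i < n) ms_comp (ms_deriv i f) g * ms_deriv j (g i).
Proof.
(* The single truncation [q] serves both sides: degree [mdeg m + 1] is read on the left by the outer
   derivative and on the right by [ms_deriv i f]. *)
apply: mseriesP => m; pose q := ms_trunc (mdeg m).+2 f.
have -> : ms_deriv j (ms_comp f g) m = ms_deriv j (subst q) m.
  rewrite [LHS]/= [RHS]/=; congr (_ *+ _); apply: ms_compE => k.
  by rewrite mdegD mdeg1 addn1 => km; rewrite ms_truncE.
rewrite ms_deriv_subst !mscoef_sum; apply: eq_bigr => i _.
rewrite !mscoefME; apply: eq_bigr => -[k1 k2] _.
congr (_ * _); symmetry; apply: ms_compE => k kk.
rewrite mcoeff_deriv ms_truncE // mdegD mdeg1 addn1 !ltnS (leq_trans kk) //.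
by rewrite -ltnS bmdeg.
Qed.

End Composition.


Lemma ms_comp_vars (n : nat) (f : mseries n K) :
  ms_comp f (fun i => series_of_mpoly 'X_i) = f.
Proof.
apply: mseriesP => m; rewrite ms_comp_truncE -[RHS](ms_truncE _ (ltnSn _)).
set q := ms_trunc _ _; rewrite -[RHS]/(series_of_mpoly q m).
congr (mscoef _ m).
elim/mpoly_ring_ind: q => [|i|p q IHp IHq|a p IHp|p q IHp IHq].
- by rewrite rmorph1 series_of_mpoly1.
- by rewrite mmapX mmap1U.
- by rewrite rmorphM /= IHp IHq series_of_mpolyM.
- by rewrite substZ IHp series_of_mpolyZ.
- by rewrite mmapD IHp IHq series_of_mpolyD.
Qed.

Lemma order_geXU (n : nat) (i : 'I_n) :
  order_ge 1 (series_of_mpoly 'X_i : mseries n K).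
Proof.
by move=> m /=; rewrite mcoeffX; case: (_ =P m) => [<-|_]; rewrite ?mdeg1 ?eqxx.
Qed.

(** * Series in z and t, and their coefficients as power series in t *)

Section TimeVariable.
Context (n : nat).
Implicit Types (f g : mseries n.+1 K) (m : 'X_{1..n.+1}) (k : 'X_{1..n}).

Lemma zidx_lift (i : 'I_n) : zidx i = lift ord_max i.
Proof. by apply: val_inj; rewrite /= /bump leqNgt ltn_ord. Qed.

Lemma zidx_eq (i j : 'I_n) : (zidx i == zidx j) = (i == j).
Proof. by []. Qed.

Lemma zidx_neq_max (i : 'I_n) : zidx i != ord_max.
Proof. by rewrite zidx_lift eq_sym neq_lift. Qed.

Lemma zexp_tmonomial k j : zexp (mnmwiden k + U_(ord_max) *+ j)%MM = k.
Proof.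
apply/mnmP => i; rewrite mnmE mnmDE mnmwiden_widen mulmnE mnm1E.
by rewrite -val_eqE /= gtn_eqF ?mul0n ?addn0.
Qed.

Lemma ord_max_tmonomial k j :
  (mnmwiden k + U_(ord_max) *+ j)%MM ord_max = j.
Proof. by rewrite mnmDE mnmwiden_ordmax mulmnE mnm1E eqxx mul1n. Qed.

Lemma tmonomialE m :
  m = (mnmwiden (zexp m) + U_(ord_max) *+ (m ord_max))%MM.
Proof.
apply/mnmP => j; case: (unliftP ord_max j) => [i ->|->]; last first.
  by rewrite ord_max_tmonomial.
rewrite -zidx_lift.
transitivity (zexp m i); first by rewrite mnmE.
by rewrite -[in LHS](zexp_tmonomial (zexp m) (m ord_max)) mnmE.
Qed.

Lemma zexpD m1 m2 : zexp (m1 + m2)%MM = (zexp m1 + zexp m2)%MM.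
Proof. by apply/mnmP => i; rewrite mnmDE !mnmE. Qed.

Lemma zexpDU m i : zexp (m + U_(zidx i))%MM = (zexp m + U_(i))%MM.
Proof. by apply/mnmP => j; rewrite mnmDE !mnmE. Qed.

Lemma mnmDU_ord_max m i : (m + U_(zidx i))%MM ord_max = m ord_max.
Proof. by rewrite mnmDE mnm1E -val_eqE /= ltn_eqF ?addn0. Qed.

Lemma zexpE m i : zexp m i = m (zidx i).
Proof. by rewrite mnmE. Qed.

(** [muni] views a polynomial as univariate in its last variable, here t, so its coefficients are
    the polynomial counterpart of [tcoef]. *)
Lemma coef_muni (p : {mpoly K[n.+1]}) j k :
  (muni p)`_j@_k = p@_(mnmwiden k + U_(ord_max) *+ j).
Proof.
rewrite muniE coef_sum raddf_sum /= [in RHS](mpolyE p) raddf_sum /=.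
apply: eq_bigr => m _; rewrite coefZ coefXn mcoeffZ mcoeffX.
rewrite -[X in 'X_[X]]/(zexp m).
have -> : (m == (mnmwiden k + U_(ord_max) *+ j)%MM) =
    (zexp m == k) && (j == m ord_max).
  apply/eqP/andP => [->|[/eqP <- /eqP ->]]; last exact: tmonomialE.
  by rewrite zexp_tmonomial ord_max_tmonomial.
case: (j == _); rewrite ?andbF ?mulr0 ?mcoeff0 //= andbT mulr1.
by rewrite mcoeffZ mcoeffX.
Qed.

Fact tcoef_is_additive j : zmod_morphism (@tcoef n K j).
Proof. by move=> f g; apply: mseriesP. Qed.

HB.instance Definition _ j :=
  GRing.isZmodMorphism.Build (mseries n.+1 K) (mseries n K) (tcoef j)
    (tcoef_is_additive j).

Lemma mdeg_tmonomial k j :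
  mdeg (mnmwiden k + U_(ord_max) *+ j)%MM = (mdeg k + j)%N.
Proof.
rewrite mdegD mdegMn mdeg1 mul1n; congr (_ + _)%N.
rewrite !mdegE big_ord_recr /= mnmwiden_ordmax addn0.
by apply: eq_bigr => i _; rewrite mnmwiden_widen.
Qed.

(** The Cauchy product in t, imported from univariate polynomials by applying [muni] to
    truncations. *)
Lemma tcoefM j f g :
  tcoef j (f * g) = \sum_(i < j.+1) tcoef i f * tcoef (j - i) g.
Proof.
apply: mseriesP => k; set m := (mnmwiden k + U_(ord_max) *+ j)%MM.
pose d := (mdeg m).+1; rewrite -[LHS]/((f * g) m).
have trunc_coef (h : mseries n.+1 K) i (l : 'X_{1..n}) :
    (i <= j)%N -> (mdeg l <= mdeg k)%N ->
    (muni (ms_trunc d h))`_i@_l = tcoef i h l.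
  move=> ij lk; rewrite coef_muni ms_truncE // ltnS !mdeg_tmonomial.
  exact: leq_add.
rewrite (mscoefM (p := ms_trunc d f) (q := ms_trunc d g)); try by
  move=> l lm; rewrite ms_truncE.
rewrite -coef_muni muniM coefM raddf_sum mscoef_sum; apply: eq_bigr => i _.
by symmetry; apply: mscoefM => l; apply: trunc_coef;
  rewrite ?leq_subr // -ltnS.
Qed.

Lemma tcoef0M f g : tcoef 0 (f * g) = tcoef 0 f * tcoef 0 g.
Proof. by rewrite tcoefM big_ord_recl big_ord0 addr0. Qed.

Lemma tcoef0_tvar : tcoef 0 (tvar : mseries n.+1 K) = 0.
Proof.
apply: mseriesP => k /=; rewrite mcoeffX.
case: eqP => // /mnmP /(_ ord_max).
by rewrite ord_max_tmonomial mnm1E eqxx.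
Qed.

Lemma tcoef0_zembed (f : mseries n K) : tcoef 0 (zembed f) = f.
Proof.
by apply: mseriesP => k /=; rewrite ord_max_tmonomial zexp_tmonomial.
Qed.

Lemma tcoef_zgrad j f i : tcoef j (zgrad f i) = grad (tcoef j f) i.
Proof.
apply: mseriesP => k /=; rewrite -zexpE zexp_tmonomial mnmwidenD mnmwiden1.
by rewrite -!addmA [(_ *+ _ + _)%MM]addmC.
Qed.

Lemma tcoef_deriv_tvar j f :
  tcoef j (ms_deriv ord_max f) = tcoef j.+1 f *+ j.+1.
Proof.
apply: mseriesP => k; rewrite mscoefMn /= ord_max_tmonomial.
by rewrite -addmA mulmSr.
Qed.

Lemma ms_deriv_zembed (f : mseries n K) i :
  ms_deriv (zidx i) (zembed f) = zembed (grad f i).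
Proof.
apply: mseriesP => m /=; rewrite mnmDU_ord_max zexpDU zexpE.
by case: eqP => //; rewrite mul0rn.
Qed.

Lemma ms_deriv_tvar_zembed (f : mseries n K) : ms_deriv ord_max (zembed f) = 0.
Proof. by apply: mseriesP => m /=; rewrite mnmDE mnm1E eqxx addn1 mul0rn. Qed.

(** Setting t = 0 respects sums, products and scalars, so only the values of the [g j] at t = 0
    matter; there they agree with the variables, whose substitution is the identity by
    [ms_comp_vars]. *)
Lemma tcoef0_comp f (g : 'I_n.+1 -> mseries n.+1 K) :
  (forall j, order_ge 1 (g j)) ->
  (forall j, tcoef 0 (g j) = tcoef 0 (series_of_mpoly 'X_j)) ->
  tcoef 0 (ms_comp f g) = tcoef 0 f.
Proof.
move=> g_order gX; rewrite -[in RHS](ms_comp_vars f).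
apply: mseriesP => k.
(* Both sides become evaluations of one and the same truncation of [f], which is then generalized to
   an arbitrary polynomial. *)
rewrite -[LHS]/(ms_comp f g _) -[RHS]/(ms_comp f _ _) !ms_comp_truncE //.
set m := (mnmwiden k + _)%MM; move: (ms_trunc _ f) => q.
rewrite -[LHS]/(tcoef 0 (mmap _ _ _) k) -[RHS]/(tcoef 0 (mmap _ _ _) k).
congr (mscoef _ k).
elim/mpoly_ring_ind: q => [|i|p q IHp IHq|a p IHp|p q IHp IHq].
- by rewrite !rmorph1.
- by rewrite !mmapX !mmap1U.
- by rewrite !rmorphM /= !tcoef0M IHp IHq.
- rewrite !substZ; apply: mseriesP => l.
  by move/(congr1 (fun h : mseries n K => h l)): IHp => /= ->.
- by rewrite !mmapD !raddfD /= IHp IHq.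
Qed.

Lemma zorder_geP d f :
  zorder_ge d f <-> (forall m, (mdeg (zexp m) < d)%N -> f m = 0).
Proof.
split=> [fd m md|fd m]; last by rewrite leqNgt; apply: contra => /fd ->.
by apply/eqP; apply: contraLR md => /fd; rewrite -leqNgt.
Qed.

Lemma zorder_ge_zgrad d f i : zorder_ge d.+1 f -> zorder_ge d (zgrad f i).
Proof.
move=> /zorder_geP fd; apply/zorder_geP => m md /=; rewrite fd ?mul0rn //.
by rewrite zexpDU mdegD mdeg1 addn1.
Qed.

End TimeVariable.

End SeriesTheory.

(** * The potential of the inverse map and its Hamilton-Jacobi equation *)

Section InverseMap.
Context (K : numFieldType) (n : nat).
Context (P : mseries n K) (Q : mseries n.+1 K).
Hypothesis ordQ : zorder_ge 2 Q.
Local Notation u := (zgrad Q).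
Local Notation G := (fun i : 'I_n => zvar i + tvar * u i).
Hypothesis F_G : forall i, zcomp (zvar i - tvar * zembed (grad P i)) G = zvar i.

(** The full substitution hidden in [zcomp], with t sent to itself, named so that the lemmas on
    [ms_comp] apply. *)
Let point : 'I_n.+1 -> mseries n.+1 K :=
  fun j => if unlift ord_max j is Some i then G i else tvar.

Let point_zidx i : point (zidx i) = G i.
Proof. by rewrite /point zidx_lift liftK. Qed.

Let point_ord_max : point ord_max = tvar.
Proof. by rewrite /point unlift_none. Qed.

Let point_order j : order_ge 1 (point j).
Proof.
apply/order_geP => m m1; rewrite /point; case: unliftP => [i _|_]; last first.
  by move/order_geP: (@order_geXU K n.+1 ord_max) => ->.
(* The factor t supplies the order 1 and [u i] contributes order 0. *)
have /order_geP u1 : order_ge 1 (tvar * u i).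
  rewrite -[1%N]addn0; apply: order_geM; last exact: order_ge0.
  exact: order_geXU.
have /order_geP z1 : order_ge 1 (zvar i : mseries n.+1 K) by apply: order_geXU.
by rewrite -[LHS]/(zvar i m + (tvar * u i) m) z1 // u1 // addr0.
Qed.

Let tcoef0_point j : tcoef 0 (point j) = tcoef 0 (series_of_mpoly 'X_j).
Proof.
rewrite /point; case: unliftP => [i ->|-> //].
by rewrite raddfD /= tcoef0M tcoef0_tvar mul0r addr0 -zidx_lift.
Qed.

Let zgrad_comp i : zcomp (zembed (grad P i)) G = u i.
Proof.
have := F_G i; rewrite /zcomp -/point.
rewrite ms_compB // ms_compM // !ms_compX // point_zidx point_ord_max.
(* After multiplication by t and addition of z_i, the claim is exactly the equation [FG]. *)
move=> FG; apply/esym/(@series_mulX_inj _ _ (@ord_max n)).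
rewrite -/tvar; apply/eqP; rewrite -subr_eq0 -(inj_eq (addrI (zvar i))).
by rewrite addrA addr0 FG.
Qed.

Let A := zcomp (zembed P) G.

Let derivA j : ms_deriv j A = \sum_(i < n) u i * ms_deriv j (G i).
Proof.
rewrite /A /zcomp -/point ms_deriv_comp // big_ord_recr /=.
rewrite ms_deriv_tvar_zembed ms_comp0 // mul0r addr0.
apply: eq_bigr => i _; rewrite -[widen_ord _ i]/(zidx i) point_zidx.
by rewrite ms_deriv_zembed -[ms_comp _ _]/(zcomp _ G) zgrad_comp.
Qed.

Let S := inner u u.

Let derivS j : ms_deriv j S = (\sum_(i < n) u i * ms_deriv j (u i)) *+ 2.
Proof.
rewrite /S /inner raddf_sum -sumrMnl; apply: eq_bigr => i _ /=.
by rewrite ms_derivM mulrC mulr2n.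
Qed.

(** Twice the defect in Q = P(G_t) - (t/2) <u, u>; doubling avoids the fraction. *)
Let Y := A *+ 2 - Q *+ 2 - tvar * S.

Let derivY_z j : ms_deriv (zidx j) Y = 0.
Proof.
rewrite /Y !raddfB !raddfMn /= derivA ms_derivM derivS ms_derivX.
rewrite -[ms_deriv _ Q]/(u j) (negPf (zidx_neq_max j)) mul0r add0r.
(* Here d_j G_i is the Kronecker delta plus t d_j u_i, and the delta extracts [u j]. *)
have -> : \sum_(i < n) u i * ms_deriv (zidx j) (G i) =
    u j + tvar * \sum_(i < n) u i * ms_deriv (zidx j) (u i).
  under eq_bigr => i _ do rewrite raddfD /= ms_derivM !ms_derivX
    (negPf (zidx_neq_max j)) mul0r add0r mulrDr mulrCA.
  rewrite big_split /= -mulr_sumr; congr (_ + _).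
  rewrite (bigD1 j) //= eqxx mulr1 big1 ?addr0 // => i ij.
  by rewrite zidx_eq eq_sym (negPf ij) mulr0.
by ring.
Qed.

(** Differentiating in t turns the defect [Y] into the defect of the Hamilton-Jacobi equation. *)
Let derivY_t : ms_deriv ord_max Y = S - ms_deriv ord_max Q *+ 2.
Proof.
rewrite /Y !raddfB !raddfMn /= derivA ms_derivM derivS ms_derivX eqxx mul1r.
have -> : \sum_(i < n) u i * ms_deriv ord_max (G i) =
    S + tvar * \sum_(i < n) u i * ms_deriv ord_max (u i).
  under eq_bigr => i _ do rewrite raddfD /= ms_derivM !ms_derivX
    eq_sym (negPf (zidx_neq_max i)) add0r eqxx mul1r mulrDr mulrCA.
  by rewrite big_split /= -mulr_sumr.
by ring.
Qed.

(** A monomial containing some z_i survives d/dz_i in characteristic zero, while all these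
    derivatives of [Y] vanish. *)
Let Y_eq0 m : (0 < mdeg (zexp m))%N -> Y m = 0.
Proof.
rewrite lt0n mdeg_eq0 => m0.
have [i mi] : exists i, m (zidx i) != 0%N.
  apply/existsP; apply: contraR m0; rewrite negb_exists => /forallP m0.
  by apply/eqP/mnmP => i; rewrite zexpE mnm0E; apply/eqP;
    rewrite -[_ == _]negbK m0.
have mU : (m - U_(zidx i) + U_(zidx i))%MM = m.
  by rewrite submK //; apply/mnm_lepP => l; rewrite mnm1E;
    case: eqP => // <-; rewrite lt0n.
have /eqP : ms_deriv (zidx i) Y (m - U_(zidx i))%MM = 0 by rewrite derivY_z.
by rewrite /= mulrn_eq0 /= mU => /eqP.
Qed.

Let Q_eq0 m : (mdeg (zexp m) < 2)%N -> Q m = 0.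
Proof. by move/zorder_geP: ordQ; apply. Qed.

(** Each [u i] has order at least 1 in z, since [Q] has order at least 2. *)
Let S_eq0 m : mdeg (zexp m) = 0%N -> S m = 0.
Proof.
move=> m0; rewrite mscoef_sum big1 // => i _.
have /zorder_geP u1 : zorder_ge 1 (u i) by apply: zorder_ge_zgrad.
rewrite mscoefME big1 // => -[k1 k2] /eqP mk; rewrite u1 ?mul0r //=.
by move/eqP: m0; rewrite [m in zexp m]mk zexpD mdegD addn_eq0 => /andP[/eqP ->].
Qed.

(** The difference of the two sides is the t-derivative of [Y], up to sign. Its monomials involving
    z vanish by [Y_eq0]; on pure powers of t, both [S] and [Q] vanish by their order in z. *)
Lemma inverse_potential_pde : ms_deriv ord_max Q *+ 2 = inner u u.
Proof.
apply/eqP; rewrite eq_sym -subr_eq0 -derivY_t; apply/eqP/mseriesP => m.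
have zexpU : zexp (m + U_(ord_max))%MM = zexp m.
  apply/mnmP => i; rewrite !zexpE mnmDE mnm1E eq_sym.
  by rewrite (negPf (zidx_neq_max i)) addn0.
have [m0|m0] := posnP (mdeg (zexp m)); last first.
  by rewrite -[LHS]/(Y _ *+ _) Y_eq0 ?mul0rn // zexpU.
rewrite derivY_t -[LHS]/(S m - _ m) mscoefMn S_eq0 //.
rewrite -[ms_deriv _ Q m]/(Q _ *+ _) Q_eq0 ?zexpU ?m0 //.
by rewrite !mul0rn subr0.
Qed.

(** At t = 0 the map G_t is the identity, so [Y] reduces to twice P - Q_[1], which [Y_eq0] kills in
    positive degree. In degrees below 2 both series vanish by their order. *)
Lemma inverse_potential_t0 : order_ge 2 P -> tcoef 0 Q = P.
Proof.
move=> /order_geP ordP; apply: mseriesP => k.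
have [k0|k0] := ltnP (mdeg k) 2.
  by rewrite ordP //= Q_eq0 // zexp_tmonomial.
have Y0 : tcoef 0 Y = (P - tcoef 0 Q) *+ 2.
  rewrite /Y !raddfB !raddfMn /= tcoef0M tcoef0_tvar mul0r subr0.
  by rewrite /A /zcomp -/point tcoef0_comp // tcoef0_zembed mulrnBl mulNrn.
have : tcoef 0 Y k = 0 by apply: Y_eq0; rewrite zexp_tmonomial (leq_trans _ k0).
by rewrite Y0 mscoefMn => /eqP; rewrite mulrn_eq0 /= subr_eq0 => /eqP.
Qed.

(** Compare coefficients of t^j in the Hamilton-Jacobi equation; the factor [j.+1] comes from the
    t-derivative. *)
Lemma inverse_potential_rec j :
  tcoef j.+1 Q *+ j.+1 *+ 2 =
  \sum_(a < j.+1) inner (grad (tcoef a Q)) (grad (tcoef (j - a) Q)).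
Proof.
rewrite -tcoef_deriv_tvar -raddfMn inverse_potential_pde raddf_sum /=.
under eq_bigr => i _ do rewrite tcoefM.
rewrite exchange_big; apply: eq_bigr => a _; apply: eq_bigr => i _.
by rewrite !tcoef_zgrad.
Qed.

End InverseMap.

(** * Reindexing the recursion, and the conclusion *)

(** With k = a + 1, the condition k + l = j + 2 leaves the single value l = j - a + 1, which lies in
    range. *)
Lemma sum_nat_antidiagonal (V : nmodType) (j : nat) (f : nat -> nat -> V) :
  \sum_(1 <= k < j.+2) \sum_(1 <= l < j.+2 | (k + l == j.+2)%N) f k l =
  \sum_(a < j.+1) f a.+1 (j - a).+1.
Proof.
rewrite big_add1 /= big_mkord; apply: eq_bigr => a _.
have aj : (a <= j)%N by rewrite -ltnS.
under eq_bigl => l.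
  rewrite addSn eqSS (_ : (a + l == j.+1)%N = (l == (j - a).+1)); last first.
    by rewrite -[RHS](eqn_add2l a) addnS subnKC.
  over.
by rewrite big_nat1_eq /= !ltnS leq_subr.
Qed.

Theorem proposition3p7 (R : realType) (n : nat) (n_ge1 : (1 <= n)%N)
    (P : mseries n R[i]) (Q : mseries n.+1 R[i])
    (ordP : order_ge 2 P) (ordQ : zorder_ge 2 Q) :
  let F : 'I_n -> mseries n.+1 R[i] :=
    fun i => zvar i - tvar * zembed (grad P i) in
  let G : 'I_n -> mseries n.+1 R[i] :=
    fun i => zvar i + tvar * zgrad Q i in
  formal_inverse F G ->
  let Qm : nat -> mseries n R[i] := fun m => tcoef m.-1 Q in
  [/\ Qm 1%N = P,
      forall m : nat, (2 <= m)%N ->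
        Qm m = ((2 * (m - 1))%N%:R)^-1 *:
          \sum_(1 <= k < m) \sum_(1 <= l < m | (k + l == m)%N)
             inner (grad (Qm k)) (grad (Qm l))
    & is_polynomial P -> forall m : nat, (1 <= m)%N -> is_polynomial (Qm m)].
Proof.
move=> F G [F_G _] Qm.
have Q1 : Qm 1%N = P by apply: inverse_potential_t0.
(* Here m = j + 2, so m - 1 is [j.+1]; the shift by one reflects that Q_[m] is the coefficient of
   t^(m-1). *)
have Qrec j : Qm j.+2 = ((2 * j.+1)%N%:R)^-1 *:
    \sum_(a < j.+1) inner (grad (Qm a.+1)) (grad (Qm (j - a).+1)).
  rewrite -(inverse_potential_rec ordQ F_G) -mulrnA mulnC.
  rewrite -[tcoef _ _ *+ _]scaler_nat scalerA.
  by rewrite mulVf ?scale1r // pnatr_eq0.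
split=> // [[|[|j]] // _|polyP].
  by rewrite subn1 sum_nat_antidiagonal.
(* Strong induction is needed because the recursion for index j + 2 uses all indices from 1 to j +
   1. *)
elim/ltn_ind => -[|[|j]] // IH _; first by rewrite Q1.
rewrite Qrec; apply/is_polynomialZ/is_polynomial_sum => a _.
apply: is_polynomial_sum => i _; apply: is_polynomialM;
  apply: is_polynomial_deriv; apply: IH => //; rewrite !ltnS ?leq_subr //.
by rewrite -ltnS.
Qed.
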